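(* Let $H$ be a real Hilbert space with $\dim(H)\geq 2$ and let $x,y$ be different points of the closed unit ball $B_H$ with $\|x\|\geq\|y\|$. Then $$d_\infty\big((x,y),\Pi(H)\big)=\begin{cases} 1-\|y\| & \text{if } \langle x,y\rangle\geq \|y\|^2+\|y\|\,\dfrac{\|x\|^2-\|y\|^2}{2},\\[2mm] \sqrt{1-\langle x,y\rangle-2\lambda\sqrt{\|x\|^2\|y\|^2-\langle x,y\rangle^2}} & \text{if } \langle x,y\rangle< \|y\|^2+\|y\|\,\dfrac{\|x\|^2-\|y\|^2}{2}, \end{cases}$$ where $$\lambda=\frac{-2\sqrt{\|x\|^2\|y\|^2-\langle x,y\rangle^2}+\sqrt{4\big(\|x\|^2+\|y\|^2-2\langle x,y\rangle\big)-(\|x\|^2-\|y\|^2)^2}}{2\big(\|x\|^2+\|y\|^2-2\langle x,y\rangle\big)}.$$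
   Context: For a real Hilbert space $H$, the dual $H^*$ is identified with $H$, a vector $y\in H$ acting on $x\in H$ by $\langle x,y\rangle$. With this identification, $\Pi(H)=\{(z,z) : z\in H,\ \|z\|=1\}\subset H\times H$, and for $(x,y)\in H\times H$, $$d_\infty\big((x,y),\Pi(H)\big):=\inf\big\{\max\{\|x-z\|,\|y-z\|\} : z\in H,\ \|z\|=1\big\}.$$ *)

(* Defs.v *)
From mathcomp Require Export all_boot all_order all_algebra.
From mathcomp Require Export all_classical all_reals all_analysis.
Export Order.TTheory GRing.Theory Num.Theory.
Export numFieldNormedType.Exports.

Set Implicit Arguments.
Unset Strict Implicit.
Unset Printing Implicit Defensive.

Local Open Scope classical_set_scope.
Local Open Scope ring_scope.

(* There are n linearly independent vectors; V may be infinite-dimensional,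
   hence no vectType and \dim. *)
Definition dim_ge (R : realType) (V : lmodType R) (n : nat) : Prop :=
  exists e : 'I_n -> V, forall c : 'I_n -> R,
    \sum_(i < n) c i *: e i = 0 -> forall i, c i = 0.

(* A real Hilbert space is a complete normed space [H] with an inner product
   [f] such that this predicate holds. *)
Definition inner_product_norm (R : realType) (H : normedModType R)
    (f : {dot H for idfun}) : Prop :=
  forall u : H, `|u| = Num.sqrt (f u u).

(* The dual of [H] is identified with [H] through the inner product, so that
   the pairs (z, f) of norm-one vectors and functionals with f z = 1 become the
   diagonal pairs below. *)
Definition PiH (R : realType) (H : normedModType R) : set (H * H) :=
  [set (z, z) | z in [set z : H | `|z| = 1]].

Definition d_infty (R : realType) (H : normedModType R) (p : H * H)
    (A : set (H * H)) : R :=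
  inf [set Num.max `|p.1 - q.1| `|p.2 - q.2| | q in A].

(* Main.v *)
Require Import Defs.
From mathcomp Require Import ring lra.

(** By definition of the infimum, the distance is the least value on the unit
    sphere of [z |-> max |x-z| |y-z|] ([d_infty_eq] uses that it is attained).

    This value is at least [|y-z| >= 1-|y|], with equality for the radial
    projection [z = y/|y|], provided that this point is at least as close to
    [x] as to [y]. Squaring that proviso gives the inequality that separates
    the two cases, so the first case is finished ([d_infty_radial]); when
    [y = 0], the radial projection of [x] plays the same role.

    In the second case the optimal point [z0] is equidistant from [x] and [y].
    It is the unit vector [z0 = (x+y)/2 + l n], where [n] is [x-y] turned by a
    right angle, away from the origin, in the plane of [x] and [y]. With
    [D = |x-y|^2] and [G] the area of the parallelogram on [x] and [y] one has
    [<n,x+y> = 2G], so [|z0| = 1] is the quadratic equation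
    [D l^2 + 2 G l + |x+y|^2/4 = 1], and the [lambda] of the theorem is its
    nonnegative root. The value at [z0] is [|x-z0|^2 = D/4 + D l^2], which the
    equation turns into [1 - <x,y> - 2 l G].

    Optimality comes from a dual certificate ([equidistant_optimal]): it is
    enough that the ray through [z0] meets the segment from [x] to [y]. With
    [K = sqrt (4D - (|x|^2-|y|^2)^2)] and [E = |x|^2-|y|^2], the explicit
    relation is [(K - 2El) x + (K + 2El) y = 4G z0]. The weight of [y] is
    visibly nonnegative, and that of [x] is nonnegative exactly because the
    radial projection of [y] is closer to [y] than to [x]
    ([weight_bound]). *)

Local Open Scope classical_set_scope.
Local Open Scope ring_scope.

(** * Real inner products *)

Section InnerProduct.
Set Implicit Arguments.
Unset Strict Implicit.
Variables (R : realType) (H : normedModType R) (dot : {dot H for idfun}).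
Implicit Types (u v x y z : H).

Lemma dotC u v : dot u v = dot v u.
Proof. by rewrite hermC expr0 mul1r. Qed.

Lemma dot_gt0 u : u != 0 -> 0 < dot u u.
Proof. exact: neq0_dnorm_gt0. Qed.

Lemma dot_ge0 u : 0 <= dot u u.
Proof.
by have [->|/dot_gt0/ltW//] := eqVneq u 0; rewrite linear0l.
Qed.

Lemma dot_eq0 u : dot u u = 0 -> u = 0.
Proof. by have [//|/dot_gt0 + e] := eqVneq u 0; rewrite e ltxx. Qed.

Lemma dotDl u v w : dot (u + v) w = dot u w + dot v w.
Proof. by rewrite linearDl. Qed.

Lemma dotDr u v w : dot w (u + v) = dot w u + dot w v.
Proof. by rewrite linearDr. Qed.

Lemma dotNl u v : dot (- u) v = - dot u v.
Proof. by rewrite linearNl. Qed.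

Lemma dotNr u v : dot u (- v) = - dot u v.
Proof. by rewrite linearNr. Qed.

Lemma dotZl (c : R) u v : dot (c *: u) v = c * dot u v.
Proof. by rewrite linearZl_LR. Qed.

Lemma dotZr (c : R) u v : dot u (c *: v) = c * dot u v.
Proof. by rewrite linearZr. Qed.

Definition dotE := (dotDl, dotDr, dotNl, dotNr, dotZl, dotZr).

Lemma dot_sub_sq u v : dot (u - v) (u - v) = dot u u + dot v v - 2 * dot u v.
Proof. by rewrite !dotE (dotC v u); ring. Qed.

(** For independent [e0], [e1], the combination [<e1,v> e0 - <e0,v> e1] is
    orthogonal to [v]; it vanishes only if [e0] and [e1] already are. *)
Lemma exists_orthogonal v : dim_ge H 2 -> exists2 u, u != 0 & dot u v = 0.
Proof.
move=> [e free_e].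
have free2 (a b : R) : a *: e ord0 + b *: e ord_max = 0 -> a = 0 /\ b = 0.
  move=> ab0; pose c (i : 'I_2) := if i == ord0 then a else b.
  have c0 : forall i, c i = 0.
    by apply: free_e; rewrite big_ord_recl big_ord1 /c /= -[RHS]ab0;
      congr (_ + _ *: e _); apply/val_inj.
  by split; [have := c0 ord0 | have := c0 ord_max].
pose u := dot (e ord_max) v *: e ord0 + (- dot (e ord0) v) *: e ord_max.
have [u0|u_neq0] := eqVneq u 0; last first.
  exists u => //.
  by rewrite !dotE; ring.
have [_ /eqP] := free2 _ _ u0; rewrite oppr_eq0 => /eqP e0v.
exists (e ord0) => //; apply/eqP => e00.
have /free2[/eqP] : 1 *: e ord0 + 0 *: e ord_max = 0.
  by rewrite e00 scaler0 scale0r addr0.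
by rewrite oner_eq0.
Qed.

Lemma exists_orthogonal_isometric v : dim_ge H 2 ->
  exists n, dot n v = 0 /\ dot n n = dot v v.
Proof.
move=> /(exists_orthogonal v)[u u_neq0 uv0].
have uu_gt0 := dot_gt0 u_neq0.
exists (Num.sqrt (dot v v / dot u u) *: u); split.
  by rewrite dotZl uv0 mulr0.
rewrite dotZl dotZr mulrA -expr2 sqr_sqrtr ?divr_ge0 ?dot_ge0//.
by rewrite divfK// gt_eqF.
Qed.

(** The area of the parallelogram spanned by [x] and [y]. *)
Definition area x y : R := Num.sqrt (dot x x * dot y y - dot x y ^+ 2).

(** The foot of the perpendicular from the origin to the line through [x] and
    [y], multiplied by [|x-y|^2] to avoid a division. *)
Definition scaled_foot x y : H :=
  (dot (x - y) (x - y) / 2) *: (x + y)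
  - ((dot x x - dot y y) / 2) *: (x - y).

Lemma scaled_foot_orthogonal x y : dot (scaled_foot x y) (x - y) = 0.
Proof.
rewrite /scaled_foot dot_sub_sq !dotE (dotC y x); ring.
Qed.

Lemma scaled_foot_sq x y : dot (scaled_foot x y) (scaled_foot x y) =
  (dot x x * dot y y - dot x y ^+ 2) * dot (x - y) (x - y).
Proof.
rewrite /scaled_foot [dot (x - y) (x - y)]dot_sub_sq !dotE (dotC y x).
by field.
Qed.

(** Cauchy-Schwarz, read off from the squared norm of the scaled foot. *)
Lemma gram_ge0 x y : x != y -> 0 <= dot x x * dot y y - dot x y ^+ 2.
Proof.
rewrite -subr_eq0 => /dot_gt0 D_gt0.
by rewrite -(pmulr_lge0 _ D_gt0) -scaled_foot_sq dot_ge0.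
Qed.

Lemma area_sq x y : x != y ->
  area x y ^+ 2 = dot x x * dot y y - dot x y ^+ 2.
Proof. by move=> /gram_ge0/sqr_sqrtr. Qed.

(** The vector [n] is [x - y] turned by a right angle, away from the origin,
    inside the plane of [x] and [y]: a rescaling of the foot of the
    perpendicular. When [x] and [y] are collinear that foot is the origin and
    the plane is not determined; any direction orthogonal to [x - y] will then
    do, and a second dimension provides one. *)
Lemma exists_rotated_difference x y : dim_ge H 2 -> x != y ->
  exists n, [/\ dot n (x - y) = 0, dot n n = dot (x - y) (x - y)
              & area x y *: n = scaled_foot x y].
Proof.
move=> dimH neq_xy.
have [G0|G_neq0] := eqVneq (area x y) 0.
  have [n [n_perp n_sq]] := exists_orthogonal_isometric (x - y) dimH.
  exists n; split => //; rewrite G0 scale0r; apply/esym/dot_eq0.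
  by rewrite scaled_foot_sq -area_sq// G0 expr0n mul0r.
exists ((area x y)^-1 *: scaled_foot x y); split.
- by rewrite dotZl scaled_foot_orthogonal mulr0.
- rewrite dotZl dotZr scaled_foot_sq -area_sq//; field; exact: G_neq0.
- by rewrite scalerA divff// scale1r.
Qed.

(** Points of the perpendicular bisector of [x] and [y], in the coordinate [l]
    along the rotated difference [n]. *)
Definition bisector_point x y n (l : R) : H := 2^-1 *: (x + y) + l *: n.

Section Bisector.
Variables (x y n : H).
Hypotheses (n_perp : dot n (x - y) = 0) (n_sq : dot n n = dot (x - y) (x - y)).

(** The distance from the origin to the line through [x] and [y] is the area
    divided by the base [|x-y|]; this is the same fact for the midpoint. *)
Lemma dot_rotated_sum : x != y -> area x y *: n = scaled_foot x y ->
  dot n (x + y) = 2 * area x y.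
Proof.
rewrite -subr_eq0 => /dot_gt0/lt0r_neq0 D_neq0 /(congr1 (dot n)).
have lin (a b : R) u w : dot n (a *: u - b *: w) = a * dot n u - b * dot n w.
  by rewrite dotDr dotNr !dotZr.
rewrite lin dotZr n_perp n_sq => e.
by apply: (mulfI D_neq0); lra.
Qed.

Lemma bisector_point_sq (l : R) :
  dot (bisector_point x y n l) (bisector_point x y n l) =
  (dot x x + dot y y + 2 * dot x y) / 4 + dot n (x + y) * l
  + dot (x - y) (x - y) * l ^+ 2.
Proof.
rewrite -n_sq /bisector_point !dotE (dotC y x) (dotC x n) (dotC y n).
by field.
Qed.

Lemma dist_sq_bisector_pointl (l : R) :
  dot (x - bisector_point x y n l) (x - bisector_point x y n l) =
  dot (x - y) (x - y) * (4^-1 + l ^+ 2).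
Proof.
have := n_sq; have := n_perp; rewrite /bisector_point !dotE.
rewrite (dotC y x) (dotC x n) (dotC y n) => nx ->.
have -> : dot n x = dot n y by lra.
by field.
Qed.

Lemma dist_sq_bisector_pointr (l : R) :
  dot (y - bisector_point x y n l) (y - bisector_point x y n l) =
  dot (x - y) (x - y) * (4^-1 + l ^+ 2).
Proof.
have := n_sq; have := n_perp; rewrite /bisector_point !dotE.
rewrite (dotC y x) (dotC x n) (dotC y n) => nx ->.
have -> : dot n x = dot n y by lra.
by field.
Qed.

End Bisector.

Hypothesis dot_norm : inner_product_norm dot.

Lemma norm_sq u : `|u| ^+ 2 = dot u u.
Proof. by rewrite dot_norm sqr_sqrtr ?dot_ge0. Qed.

Lemma norm_sub_sq u v :
  `|u - v| ^+ 2 = `|u| ^+ 2 + `|v| ^+ 2 - 2 * dot u v.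
Proof. by rewrite !norm_sq dot_sub_sq. Qed.

Lemma dot_le_norm u v : dot u v <= `|u| * `|v|.
Proof.
have [->|neq_uv] := eqVneq u v; first by rewrite -norm_sq -expr2.
have := gram_ge0 neq_uv; rewrite -!norm_sq subr_ge0 -exprMn => dot_sq.
apply: le_trans (ler_norm _) _.
by rewrite -(ler_pXn2r (n := 2)) ?nnegrE ?mulr_ge0// real_normK// num_real.
Qed.

Lemma midpoint_sq_le1 x y : `|x| <= 1 -> `|y| <= 1 ->
  (`|x| ^+ 2 + `|y| ^+ 2 + 2 * dot x y) / 4 <= 1.
Proof.
move=> x1 y1; have := dot_le_norm x y.
have := normr_ge0 x; have := normr_ge0 y; nra.
Qed.

(** Among unit vectors, [z0] maximises the inner product with its nonnegative
    multiple [a x + b y], hence minimises [a |x-z|^2 + b |y-z|^2]. A unit vector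
    strictly closer than [z0] to both [x] and [y] would make this weighted sum
    smaller. *)
Lemma equidistant_optimal x y z0 (a b h : R) :
  0 <= a -> 0 <= b -> 0 < a + b -> 0 <= h ->
  a *: x + b *: y = h *: z0 -> `|z0| = 1 -> `|x - z0| = `|y - z0| ->
  forall z, `|z| = 1 -> `|x - z0| <= Num.max `|x - z| `|y - z|.
Proof.
move=> a0 b0 ab0 h0 balance z0_1 xy z z1.
rewrite leNgt; apply/negP; rewrite gt_max => /andP[xz yz].
have xz2 : `|x - z| ^+ 2 < `|x - z0| ^+ 2 by rewrite ltr_pXn2r ?nnegrE.
have yz2 : `|y - z| ^+ 2 < `|y - z0| ^+ 2 by rewrite -xy ltr_pXn2r ?nnegrE// xy.
have hzz : 0 <= h * `|z0 - z| ^+ 2 by rewrite mulr_ge0// sqr_ge0.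
have hz : a * dot x z + b * dot y z = h * dot z0 z.
  by rewrite -!dotZl -dotDl balance.
have hz0 : a * dot x z0 + b * dot y z0 = h.
  by rewrite -!dotZl -dotDl balance dotZl -norm_sq z0_1 expr1n mulr1.
move: hzz xz2 yz2; rewrite !norm_sub_sq z0_1 z1 expr1n => hzz xz2 yz2.
have x_gain : 0 < dot x z - dot x z0 by lra.
have y_gain : 0 < dot y z - dot y z0 by lra.
have aP := mulr_ge0 a0 (ltW x_gain); have bQ := mulr_ge0 b0 (ltW y_gain).
have [a_gt0|a_le0] := ltP 0 a.
  by have := mulr_gt0 a_gt0 x_gain; lra.
have b_gt0 : 0 < b by lra.
by have := mulr_gt0 b_gt0 y_gain; lra.
Qed.

Lemma d_infty_eq x y z0 (r : R) : `|z0| = 1 ->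
  Num.max `|x - z0| `|y - z0| = r ->
  (forall z, `|z| = 1 -> r <= Num.max `|x - z| `|y - z|) ->
  d_infty (x, y) (@PiH R H) = r.
Proof.
move=> z0_1 attained lower.
set S := [set Num.max `|(x, y).1 - q.1| `|(x, y).2 - q.2| | q in @PiH R H].
have Sr : S r by exists (z0, z0) => //=; exists z0.
have lbS : lbound S r by move=> _ [_ [z z1 <-] <-]; exact: lower.
apply/eqP; rewrite eq_le; apply/andP; split.
  by apply: ge_inf => //; exists r.
by apply: lb_le_inf => //; exists r.
Qed.

End InnerProduct.

(** * Scalar inequalities *)

Section Numbers.
Variable R : realFieldType.
Implicit Types (a b s A B G K D l : R).

(** Cauchy-Schwarz makes both terms of the decomposition nonnegative. They vanish
    together only if [a = b] or [a + b = 2], and the latter forces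
    [a = b = 1]; then [s = a * b] means that the points coincide. *)
Lemma discriminant_gt0 a b s : 0 <= b -> b <= a -> a <= 1 -> s <= a * b ->
  0 < a ^+ 2 + b ^+ 2 - 2 * s ->
  0 < 4 * (a ^+ 2 + b ^+ 2 - 2 * s) - (a ^+ 2 - b ^+ 2) ^+ 2.
Proof.
move=> b0 ba a1 sab D0.
have -> : 4 * (a ^+ 2 + b ^+ 2 - 2 * s) - (a ^+ 2 - b ^+ 2) ^+ 2
  = 8 * (a * b - s) + (a - b) ^+ 2 * (4 - (a + b) ^+ 2) by ring.
have [le_ab|lt_ba] := leP a b.
  have ab : a = b by lra.
  by move: D0; rewrite ab subrr; nra.
have : 0 < (a - b) ^+ 2 by rewrite exprn_gt0// subr_gt0.
have : 0 < 4 - (a + b) ^+ 2 by nra.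
nra.
Qed.

(** With [A], [b], [s] standing for [|x|^2], [|y|], [<x,y>], this is the
    nonnegativity of the weight of [x] in the optimality certificate. Only
    [s > b^2] is at stake. Then the difference of the squared sides is
    [|x-y|^2] times the difference of the squares of [b (A - b^2)] and
    [2 (s - b^2)], which the last hypothesis compares. *)
Lemma weight_bound A b s G K : 0 <= b -> 0 <= A - b ^+ 2 ->
  0 <= G -> G ^+ 2 = A * b ^+ 2 - s ^+ 2 ->
  0 <= K -> K ^+ 2 = 4 * (A + b ^+ 2 - 2 * s) - (A - b ^+ 2) ^+ 2 ->
  0 <= A + b ^+ 2 - 2 * s -> s <= b ^+ 2 + b * ((A - b ^+ 2) / 2) ->
  (s - b ^+ 2) * K <= G * (A - b ^+ 2).
Proof.
move=> b0 E0 G0 GE K0 KE D0 near.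
have [Y0|Y0] := leP (s - b ^+ 2) 0.
  by rewrite (@le_trans _ _ 0) ?mulr_ge0 ?mulr_le0_ge0.
rewrite -(ler_pXn2r (n := 2)) ?nnegrE ?mulr_ge0 ?(ltW Y0)//.
rewrite !exprMn GE KE -subr_ge0.
have -> : (A * b ^+ 2 - s ^+ 2) * (A - b ^+ 2) ^+ 2
    - (s - b ^+ 2) ^+ 2 * (4 * (A + b ^+ 2 - 2 * s) - (A - b ^+ 2) ^+ 2)
  = (A + b ^+ 2 - 2 * s) *
    ((b * (A - b ^+ 2)) ^+ 2 - (2 * (s - b ^+ 2)) ^+ 2) by ring.
rewrite mulr_ge0// subr_ge0 ler_pXn2r ?nnegrE ?mulr_ge0 ?(ltW Y0)//; lra.
Qed.

Lemma quadratic_root A B s G K D l : D = A + B - 2 * s -> D != 0 ->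
  G ^+ 2 = A * B - s ^+ 2 -> K ^+ 2 = 4 * D - (A - B) ^+ 2 ->
  l = (- 2 * G + K) / (2 * D) ->
  (A + B + 2 * s) / 4 + 2 * G * l + D * l ^+ 2 = 1.
Proof.
move=> DE D0 GE KE lE.
have {}KE : (2 * D * l + 2 * G) ^+ 2 = 4 * D - (A - B) ^+ 2.
  by rewrite -KE lE; congr (_ ^+ 2); field.
have D4 : 4 * D != 0 by rewrite mulf_neq0.
by apply: (mulfI D4); move: KE GE; rewrite DE; nra.
Qed.

End Numbers.

(** * The two cases *)

Lemma norm_radial (R : realType) (H : normedModType R) (u : H) :
  u != 0 -> `|(`|u|^-1 *: u)| = 1.
Proof. by move=> u0; rewrite normrZ normfV normr_id mulVf ?normr_eq0. Qed.

Lemma dist_radial (R : realType) (H : normedModType R) (u : H) :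
  u != 0 -> `|u| <= 1 -> `|u - `|u|^-1 *: u| = 1 - `|u|.
Proof.
move=> u0 u1; have -> : u - `|u|^-1 *: u = (1 - `|u|^-1) *: u.
  by rewrite scalerBl scale1r.
rewrite normrZ -{2}[`|u|]normr_id -normrM mulrBl mul1r mulVf ?normr_eq0//.
by rewrite distrC ger0_norm ?subr_ge0.
Qed.

Lemma scaler_sumdiff (R : nzRingType) (V : lmodType R) (a b : R) (u v : V) :
  a *: (u + v) - b *: (u - v) = (a - b) *: u + (a + b) *: v.
Proof.
by rewrite scalerDr scalerBr opprB [_ - b *: u]addrC addrACA -scalerBl -scalerDl.
Qed.

Section Distance.
Set Implicit Arguments.
Unset Strict Implicit.
Variables (R : realType) (H : normedModType R) (dot : {dot H for idfun}).
Hypothesis dot_norm : inner_product_norm dot.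
Variables x y : H.
Hypotheses (neq_xy : x != y) (x_ball : `|x| <= 1) (y_ball : `|y| <= 1)
  (le_yx : `|y| <= `|x|).
Let s := dot x y.

Lemma d_infty_radial :
  `|y| ^+ 2 + `|y| * ((`|x| ^+ 2 - `|y| ^+ 2) / 2) <= s ->
  d_infty (x, y) (@PiH R H) = 1 - `|y|.
Proof.
move=> far.
have lower z : `|z| = 1 -> 1 - `|y| <= Num.max `|x - z| `|y - z|.
  move=> z1; rewrite le_max; apply/orP; right.
  by rewrite -z1 distrC lerB_dist.
have [y0|y_neq0] := eqVneq y 0.
  (* Every unit vector is at distance [1 - |y| = 1] from [y]; the one in the
     direction of [x] is close enough to [x]. *)
  have x_neq0 : x != 0 by rewrite -y0.
  apply: (d_infty_eq (norm_radial x_neq0)) => //.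
  rewrite dist_radial// y0 sub0r normrN norm_radial// normr0 subr0.
  by apply/max_idPr; rewrite gerBl.
have Ny_neq0 : `|y| != 0 by rewrite normr_eq0.
have z1 := norm_radial y_neq0; have yz := dist_radial y_neq0 y_ball.
apply: (d_infty_eq z1) => //; rewrite yz; apply/max_idPr.
rewrite -(ler_pXn2r (n := 2)) ?nnegrE ?subr_ge0// (norm_sub_sq dot_norm) z1.
rewrite dotZr -/s -subr_ge0.
have -> : (1 - `|y|) ^+ 2 - (`|x| ^+ 2 + 1 ^+ 2 - 2 * (`|y|^-1 * s))
  = 2 * `|y|^-1 *
    (s - (`|y| ^+ 2 + `|y| * ((`|x| ^+ 2 - `|y| ^+ 2) / 2))) by field.
by rewrite !mulr_ge0 ?invr_ge0 ?subr_ge0.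
Qed.

Let D := dot (x - y) (x - y).
Let G := area dot x y.
Let K := Num.sqrt (4 * D - (`|x| ^+ 2 - `|y| ^+ 2) ^+ 2).
Let l := (- 2 * G + K) / (2 * D).

(** On the common boundary of the two cases the certificate has weight [0] at
    [x], so both formulas hold there and [s] may equal the bound. *)
Lemma d_infty_bisector : dim_ge H 2 ->
  s <= `|y| ^+ 2 + `|y| * ((`|x| ^+ 2 - `|y| ^+ 2) / 2) ->
  d_infty (x, y) (@PiH R H) = Num.sqrt (1 - s - 2 * l * G).
Proof.
move=> dimH near.
have [n [n_perp n_sq Gn]] := exists_rotated_difference dot dimH neq_xy.
have n_sum := dot_rotated_sum n_perp n_sq neq_xy Gn.
have D_gt0 : 0 < D by rewrite dot_gt0// subr_eq0.
have D_neq0 := lt0r_neq0 D_gt0.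
have DE : D = `|x| ^+ 2 + `|y| ^+ 2 - 2 * s.
  by rewrite !(norm_sq dot_norm) /D dot_sub_sq.
have G_ge0 : 0 <= G := sqrtr_ge0 _.
have GE : G ^+ 2 = `|x| ^+ 2 * `|y| ^+ 2 - s ^+ 2.
  by rewrite area_sq// !(norm_sq dot_norm).
have K2_gt0 : 0 < 4 * D - (`|x| ^+ 2 - `|y| ^+ 2) ^+ 2.
  rewrite DE; apply: discriminant_gt0 => //; last by rewrite -DE.
  exact: dot_le_norm.
have K_gt0 : 0 < K by rewrite sqrtr_gt0.
have KE := sqr_sqrtr (ltW K2_gt0); rewrite -/K in KE.
have root :=
  quadratic_root DE D_neq0 GE KE (erefl : l = (- 2 * G + K) / (2 * D)).
have lE : 2 * D * l = K - 2 * G.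
  by rewrite /l mulrC divfK ?mulf_neq0// addrC mulNr.
(* The root is nonnegative because the midpoint of [x] and [y] lies in the
   closed unit ball. *)
have l_ge0 : 0 <= l.
  rewrite -(pmulr_rge0 _ D_gt0) -(pmulr_rge0 _ (ltr0n R 2)) mulrA lE subr_ge0.
  rewrite -(ler_pXn2r (n := 2)) ?nnegrE ?mulr_ge0 ?(ltW K_gt0)//.
  rewrite KE exprMn GE -subr_ge0.
  have -> : 4 * D - (`|x| ^+ 2 - `|y| ^+ 2) ^+ 2
      - 2 ^+ 2 * (`|x| ^+ 2 * `|y| ^+ 2 - s ^+ 2)
    = 4 * D * (1 - (`|x| ^+ 2 + `|y| ^+ 2 + 2 * s) / 4).
    by rewrite DE; field.
  by rewrite !mulr_ge0 ?(ltW D_gt0)// subr_ge0 midpoint_sq_le1.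
set z0 := bisector_point x y n l.
have z0_1 : `|z0| = 1.
  apply/eqP; rewrite -(@eqrXn2 _ 2)// expr1n (norm_sq dot_norm).
  by rewrite bisector_point_sq// n_sum -/G -/D -/s -!(norm_sq dot_norm) root.
have sqrtD u : `|u| = Num.sqrt (dot u u) by exact: dot_norm.
have xz0 : `|x - z0| = Num.sqrt (1 - s - 2 * l * G).
  rewrite sqrtD dist_sq_bisector_pointl//; congr Num.sqrt.
  by rewrite -/D; move: root; rewrite DE; lra.
have yz0 : `|y - z0| = `|x - z0|.
  by rewrite !sqrtD dist_sq_bisector_pointl// dist_sq_bisector_pointr.
apply: (d_infty_eq z0_1); first by rewrite yz0 maxxx.
rewrite -xz0; set E := `|x| ^+ 2 - `|y| ^+ 2.
have E_ge0 : 0 <= E by rewrite subr_ge0 ler_pXn2r ?nnegrE.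
(* Intersecting the line through [x] and [y] with the ray through [z0] gives
   the weights, up to a common factor. *)
have weight_x : 0 <= K - 2 * E * l.
  have := weight_bound (normr_ge0 y) E_ge0 G_ge0 GE (ltW K_gt0).
  rewrite -DE => /(_ KE (ltW D_gt0) near); rewrite -/E => GE_ge.
  have weightE : D * (K - 2 * E * l) = 2 * (G * E - (s - `|y| ^+ 2) * K).
    have -> : D * (K - 2 * E * l) = D * K - E * (2 * D * l) by ring.
    by rewrite lE /E DE; ring.
  by rewrite -(pmulr_rge0 _ D_gt0) weightE mulr_ge0 ?subr_ge0.
have weight_y : 0 <= K + 2 * E * l.
  by rewrite addr_ge0 ?(ltW K_gt0)// mulr_ge0// mulr_ge0.
apply: (equidistant_optimal dot_norm weight_x weight_y _ (h := 4 * G)) => //.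
- by lra.
- by rewrite mulr_ge0.
rewrite /z0 /bisector_point scalerDr !scalerA (mulrAC 4 G l) -(scalerA _ G n) Gn.
rewrite /scaled_foot -/D scalerBr !scalerA addrA -scalerDl -!(norm_sq dot_norm) -/E.
rewrite scaler_sumdiff; congr (_ *: _ + _ *: _); move: lE; lra.
Qed.

End Distance.

Theorem theorem2p13 (R : realType) (H : completeNormedModType R)
    (dot : {dot H for idfun}) (dot_norm : inner_product_norm dot)
    (dimH : dim_ge H 2) (x y : H) (neq_xy : x <> y)
    (x_ball : `|x| <= 1) (y_ball : `|y| <= 1) (le_yx : `|y| <= `|x|) :
  let s := dot x y in
  let lambda :=
    (- 2 * Num.sqrt (`|x| ^+ 2 * `|y| ^+ 2 - s ^+ 2) +
      Num.sqrt (4 * (`|x| ^+ 2 + `|y| ^+ 2 - 2 * s) -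
                (`|x| ^+ 2 - `|y| ^+ 2) ^+ 2)) /
    (2 * (`|x| ^+ 2 + `|y| ^+ 2 - 2 * s)) in
  d_infty (x, y) (@PiH R H) =
    if s >= `|y| ^+ 2 + `|y| * ((`|x| ^+ 2 - `|y| ^+ 2) / 2)
    then 1 - `|y|
    else Num.sqrt (1 - s -
           2 * lambda * Num.sqrt (`|x| ^+ 2 * `|y| ^+ 2 - s ^+ 2)).
Proof.
move/eqP: neq_xy => neq_xy s lambda.
case: ifPn => [far|]; first exact: d_infty_radial far.
rewrite -ltNge => /ltW near.
rewrite (d_infty_bisector dot_norm neq_xy)// /area dot_sub_sq.
by rewrite -!(norm_sq dot_norm).
Qed.
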